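(* Let $X$ be a locally path connected space, let $x\in X$, and let $H$ be an open normal subgroup of the quasitopological fundamental group $\pi_1^{qtop}(X,x)$. Then there exists an open cover $\mathcal{U}$ of $X$ such that $\pi(\mathcal{U},x)\leq H$.
   Context: The quasitopological fundamental group $\pi_1^{qtop}(X,x)$ is the group $\pi_1(X,x)$ with the quotient topology induced by the map $q:\Omega(X,x)\to\pi_1(X,x)$, $q(\gamma)=[\gamma]$, where $\Omega(X,x)$ is the space of loops in $X$ based at $x$ with the compact-open topology. (In this topology translations and inversion are continuous, but it need not be a topological group.) For an open cover $\mathcal{U}=\{U_i\mid i\in I\}$ of $X$, the Spanier group $\pi(\mathcal{U},x)$ is the subgroup of $\pi_1(X,x)$ consisting of all homotopy classes having a representative of the form $\prod_{j=1}^{n}u_jv_ju_j^{-1}$, where each $u_j$ is an arbitrary path starting at $x$ and each $v_j$ is a loop based at $u_j(1)$ lying inside one of the open sets of $\mathcal{U}$. *)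

(* Defs.v *)
From HB Require Import structures.
From mathcomp Require Import all_boot all_order all_algebra.
From mathcomp Require Import generic_quotient.
From mathcomp Require Import all_classical all_reals.
From mathcomp Require Import topology normedtype homotopy.
From mathcomp Require Import lra.

Set Implicit Arguments.
Unset Strict Implicit.
Unset Printing Implicit Defensive.

Import Order.TTheory GRing.Theory Num.Theory.
Import numFieldNormedType.Exports.

Local Open Scope classical_set_scope.
Local Open Scope ring_scope.
Local Open Scope quotient_scope.

Section continuity.
Context {R : realType}.

Lemma continuous_glue {S T : topologicalType} (phi : S -> R) (c : R)
    (f g : S -> T) :
  continuous phi -> continuous f -> continuous g ->
  (forall s, phi s = c -> f s = g s) ->
  continuous (fun s => if phi s <= c then f s else g s).
Proof.
move=> cphi cf cg fg s A nA.
suff : nbhs s ((fun s => if phi s <= c then f s else g s) @^-1` A) by [].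
move: nA; have [lt_sc|lt_cs|eq_sc] := ltgtP (phi s) c => /= nA.
- have nphi : nbhs s [set t | phi t < c] := cphi s _ (lt_nbhsl lt_sc).
  have nf : nbhs s (f @^-1` A) := cf s _ nA.
  by apply: filterS2 nphi nf => t /= /ltW ->.
- have nphi : nbhs s [set t | c < phi t] := cphi s _ (lt_nbhsr lt_cs).
  have ng : nbhs s (g @^-1` A) := cg s _ nA.
  by apply: filterS2 nphi ng => t /=; rewrite leNgt => ->.
- have nf : nbhs s (f @^-1` A) := cf s _ nA.
  have ng : nbhs s (g @^-1` A) by apply: (cg s); rewrite -fg.
  by apply: filterS2 nf ng => t /= Aft Agt; case: ifP.
Qed.

Lemma continuous_pair {S T U : topologicalType} (f : S -> T) (g : S -> U) :
  continuous f -> continuous g -> continuous (fun s => (f s, g s)).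
Proof. by move=> cf cg s; apply: cvg_pair; [exact: cf|exact: cg]. Qed.

Lemma continuous_compose {S T U : topologicalType} (f : S -> T) (g : T -> U) :
  continuous g -> continuous f -> continuous (fun s => g (f s)).
Proof. by move=> cg cf s; apply: continuous_comp; [exact: cf|exact: cg]. Qed.

End continuity.

Section unit_interval.
Variable R : realType.

Definition unit_itv : Type := set_type (`[0%R, 1%R]%classic : set R).
HB.instance Definition _ := Topological.on unit_itv.

Definition uval (s : unit_itv) : R := \val s.

Fact clamp_subproof (t : R) :
  Num.max 0 (Num.min 1 t) \in (`[0%R, 1%R]%classic : set R).
Proof.
apply/mem_set; rewrite /= in_itv /= le_max lexx /= ge_max ler01 /=.
by rewrite ge_min lexx.
Qed.

(* The retraction of the real line onto the unit interval. *)
Definition clamp (t : R) : unit_itv := SigSub (clamp_subproof t).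

Lemma uval_itv (s : unit_itv) : 0 <= uval s <= 1.
Proof. by have := set_valP s; rewrite /= in_itv. Qed.

Lemma uval_inj : injective uval.
Proof. by move=> [a pa] [b pb] /= ab; exact: eq_sig_hprop. Qed.

Lemma clampE (t : R) : 0 <= t <= 1 -> uval (clamp t) = t.
Proof.
by move=> /andP[t0 t1]; rewrite /uval /= min_r // max_r.
Qed.

Lemma clamp_le0 (t : R) : t <= 0 -> clamp t = clamp 0.
Proof.
move=> t0; apply: uval_inj; rewrite /uval /=.
by rewrite (min_r (le_trans t0 ler01)) (min_r ler01) !max_l.
Qed.

Lemma clamp_ge1 (t : R) : 1 <= t -> clamp t = clamp 1.
Proof. by move=> t1; apply: uval_inj; rewrite /uval /= !min_l. Qed.

Lemma uvalK : cancel uval clamp.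
Proof. by move=> s; apply: uval_inj; rewrite clampE // uval_itv. Qed.

Lemma uval_continuous : continuous uval.
Proof. exact: initial_continuous. Qed.

Lemma clamp_continuous : continuous clamp.
Proof.
apply: continuous_comp_initial.
rewrite (_ : _ \o _ = Order.max_fun (cst 0) (Order.min_fun (cst 1) idfun)) //.
apply: max_fun_continuous; first by move=> ?; exact: cvg_cst.
by apply: min_fun_continuous => ?; [exact: cvg_cst|exact: cvg_id].
Qed.

Fact unit_itv_neq : clamp 0 != clamp 1.
Proof.
apply/eqP => /(congr1 uval); rewrite !clampE ?lexx ?ler01 //.
by move/eqP; rewrite eq_sym oner_eq0.
Qed.

HB.instance Definition _ := Choice.on unit_itv.
HB.instance Definition _ :=
  @isBiPointed.Build unit_itv (clamp 0) (clamp 1) unit_itv_neq.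

Lemma uval0 : uval zero = 0.
Proof. by rewrite clampE // lexx ler01. Qed.

Lemma uval1 : uval one = 1.
Proof. by rewrite clampE // lexx ler01. Qed.

End unit_interval.

Section continuity_rules.
Context {R : realType} {S : topologicalType}.
Implicit Types f g : S -> R.

Lemma continuous_add f g :
  continuous f -> continuous g -> continuous (fun s => f s + g s).
Proof. by move=> cf cg s; apply: cvgD; [exact: cf|exact: cg]. Qed.

Lemma continuous_sub f g :
  continuous f -> continuous g -> continuous (fun s => f s - g s).
Proof. by move=> cf cg s; apply: cvgB; [exact: cf|exact: cg]. Qed.

Lemma continuous_mul f g :
  continuous f -> continuous g -> continuous (fun s => f s * g s).
Proof. by move=> cf cg s; apply: cvgM; [exact: cf|exact: cg]. Qed.

Lemma continuous_const {T : topologicalType} (c : T) :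
  continuous (fun _ : S => c).
Proof. by move=> s; exact: cvg_cst. Qed.

Lemma continuous_uval (h : S -> unit_itv R) :
  continuous h -> continuous (fun s => uval (h s)).
Proof. by apply: continuous_compose; exact: uval_continuous. Qed.

Lemma continuous_clamp f : continuous f -> continuous (fun s => clamp (f s)).
Proof. by apply: continuous_compose; exact: clamp_continuous. Qed.

End continuity_rules.

Section continuity_projections.
Context {S T : topologicalType}.

Lemma continuous_fst : continuous (fun z : S * T => z.1).
Proof. by move=> z; exact: cvg_fst. Qed.

Lemma continuous_snd : continuous (fun z : S * T => z.2).
Proof. by move=> z; exact: cvg_snd. Qed.

Lemma continuous_idfun : continuous (fun s : S => s).
Proof. by move=> s; exact: cvg_id. Qed.

End continuity_projections.

Ltac prove_continuous := repeat first
  [ assumption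
  | exact: continuous_const
  | exact: continuous_idfun
  | exact: continuous_fst
  | exact: continuous_snd
  | exact: cts_fun
  | apply: continuous_pair
  | apply: continuous_uval
  | apply: continuous_clamp
  | apply: continuous_sub
  | apply: continuous_add
  | apply: continuous_mul
  | apply: continuous_compose
  ].

Section path_operations.
Context {R : realType} {X : topologicalType}.
Local Notation I := (unit_itv R).

Definition concat_fun (p q : I -> X) (s : I) : X :=
  if uval s <= 2^-1 then p (clamp (2 * uval s))
  else q (clamp (2 * uval s - 1)).

Section concat.
Context {x y z : X} (p : {path I from x to y in X}) (q : {path I from y to z in X}).

Fact concat_continuous : continuous (concat_fun p q).
Proof.
apply: continuous_glue; [by prove_continuous..|].
move=> s ->; rewrite mulfV ?subrr ?pnatr_eq0 //.
by rewrite -[clamp 1]/one -[clamp 0]/zero path_one path_zero.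
Qed.

Fact concat_zero : concat_fun p q zero = x.
Proof.
rewrite /concat_fun uval0 invr_ge0 ler0n mulr0 -[clamp 0]/zero.
exact: path_zero.
Qed.

Fact concat_one : concat_fun p q one = z.
Proof.
rewrite /concat_fun uval1 ifF; last by apply/negbTE; rewrite -ltNge; lra.
by rewrite (_ : 2 * 1 - 1 = 1); [exact: path_one|lra].
Qed.

Definition path_concat : {path I from x to z in X} :=
  mk_path concat_continuous concat_zero concat_one.

End concat.

Section reverse.
Context {x y : X} (p : {path I from x to y in X}).

Definition rev_fun (s : I) : X := p (clamp (1 - uval s)).

Fact rev_continuous : continuous rev_fun.
Proof. by rewrite /rev_fun; prove_continuous. Qed.

Fact rev_zero : rev_fun zero = y.
Proof. by rewrite /rev_fun uval0 subr0 path_one. Qed.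

Fact rev_one : rev_fun one = x.
Proof. by rewrite /rev_fun uval1 subrr path_zero. Qed.

Definition path_rev : {path I from y to x in X} :=
  mk_path rev_continuous rev_zero rev_one.

End reverse.

Definition path_cst (x : X) : {path I from x to x in X} := cst x.

End path_operations.

Section homotopy.
Context {R : realType} {X : topologicalType}.
Local Notation I := (unit_itv R).
Local Notation path x y := {path I from x to y in X}.

(* Homotopy relative to the endpoints: the first coordinate of the square is
   the path parameter, the second one is the time of the deformation. *)
Definition path_homotopic {x y : X} (p q : path x y) : Prop :=
  exists F : I * I -> X,
    [/\ continuous F,
        (forall s, F (s, zero) = p s),
        (forall s, F (s, one) = q s),
        (forall t, F (zero, t) = x) &
        (forall t, F (one, t) = y)].

Lemma path_homotopic_refl {x y : X} (p : path x y) : path_homotopic p p.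
Proof.
exists (fun z => p z.1); split => //= [|t|t]; first by prove_continuous.
- exact: path_zero.
- exact: path_one.
Qed.

Lemma path_homotopic_sym {x y : X} (p q : path x y) :
  path_homotopic p q -> path_homotopic q p.
Proof.
move=> [F [cF F0 F1 Fx Fy]].
exists (fun z => F (z.1, clamp (1 - uval z.2))); split => //=.
- by prove_continuous.
- by move=> s; rewrite uval0 subr0; exact: F1.
- by move=> s; rewrite uval1 subrr; exact: F0.
Qed.

Lemma path_homotopic_trans {x y : X} (p q r : path x y) :
  path_homotopic p q -> path_homotopic q r -> path_homotopic p r.
Proof.
move=> [F [cF F0 F1 Fx Fy]] [G [cG G0 G1 Gx Gy]].
exists (fun z => if uval z.2 <= 2^-1 then F (z.1, clamp (2 * uval z.2))
                 else G (z.1, clamp (2 * uval z.2 - 1))); split => /=.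
- apply: (continuous_glue (phi := fun z : I * I => uval z.2));
    [by prove_continuous..|].
  move=> [s t] /= ->; rewrite mulfV ?pnatr_eq0 // subrr.
  by rewrite -[clamp 1]/one -[clamp 0]/zero F1 G0.
- by move=> s; rewrite uval0 invr_ge0 ler0n mulr0; exact: F0.
- move=> s; rewrite uval1 ifF; last by apply/negbTE; rewrite -ltNge; lra.
  by rewrite (_ : 2 * 1 - 1 = 1); [exact: G1|lra].
- by move=> t; case: ifP.
- by move=> t; case: ifP.
Qed.

Lemma path_homotopic_concat {x y z : X} (p p' : path x y) (q q' : path y z) :
  path_homotopic p p' -> path_homotopic q q' ->
  path_homotopic (path_concat p q) (path_concat p' q').
Proof.
move=> [F [cF F0 F1 Fx Fy]] [G [cG G0 G1 Gx Gy]].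
exists (fun z => if uval z.1 <= 2^-1 then F (clamp (2 * uval z.1), z.2)
                 else G (clamp (2 * uval z.1 - 1), z.2)); split => /=.
- apply: (continuous_glue (phi := fun z : I * I => uval z.1));
    [by prove_continuous..|].
  move=> [s t] /= ->; rewrite mulfV ?pnatr_eq0 // subrr.
  by rewrite -[clamp 1]/one -[clamp 0]/zero Fy Gx.
- by move=> s; rewrite F0 G0.
- by move=> s; rewrite F1 G1.
- by move=> t; rewrite uval0 invr_ge0 ler0n mulr0; exact: Fx.
- move=> t; rewrite uval1 ifF; last by apply/negbTE; rewrite -ltNge; lra.
  by rewrite (_ : 2 * 1 - 1 = 1); [exact: Gy|lra].
Qed.

Lemma path_homotopic_rev {x y : X} (p q : path x y) :
  path_homotopic p q -> path_homotopic (path_rev p) (path_rev q).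
Proof.
move=> [F [cF F0 F1 Fx Fy]].
exists (fun z => F (clamp (1 - uval z.1), z.2)); split => /=.
- by prove_continuous.
- by move=> s; exact: F0.
- by move=> s; exact: F1.
- by move=> t; rewrite uval0 subr0; exact: Fy.
- by move=> t; rewrite uval1 subrr; exact: Fx.
Qed.

(* Straight-line homotopy between two reparametrizations of a path. *)
Lemma path_homotopic_reparam {x y a b : X} (p : path x y) (q r : path a b)
    (f g : I -> R) :
  continuous f -> continuous g -> f zero = g zero -> f one = g one ->
  (forall s, q s = p (clamp (f s))) -> (forall s, r s = p (clamp (g s))) ->
  path_homotopic q r.
Proof.
move=> cf cg fg0 fg1 qE rE.
exists (fun z => p (clamp (f z.1 + uval z.2 * (g z.1 - f z.1)))); split => /=.
- have cf1 : continuous (fun z : I * I => f z.1).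
    by apply: continuous_compose cf _; prove_continuous.
  have cg1 : continuous (fun z : I * I => g z.1).
    by apply: continuous_compose cg _; prove_continuous.
  by apply: (continuous_compose (g := p)); prove_continuous.
- by move=> s; rewrite uval0 mul0r addr0 qE.
- by move=> s; rewrite uval1 mul1r addrC subrK rE.
- by move=> t; rewrite fg0 subrr mulr0 addr0 -rE path_zero.
- by move=> t; rewrite fg1 subrr mulr0 addr0 -rE path_one.
Qed.

Lemma path_homotopic_eq {x y : X} (p q : path x y) :
  p =1 q -> path_homotopic p q.
Proof. by move=> /path_eqP ->; exact: path_homotopic_refl. Qed.

Lemma concat_fun_left (p q : I -> X) (u : R) :
  0 <= u <= 2^-1 -> concat_fun p q (clamp u) = p (clamp (2 * u)).
Proof.
move=> /andP[u0 u2]; rewrite /concat_fun clampE ?u2 //.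
by apply/andP; split; lra.
Qed.

Lemma concat_fun_right (p q : I -> X) (u : R) :
  2^-1 < u <= 1 -> concat_fun p q (clamp u) = q (clamp (2 * u - 1)).
Proof.
move=> /andP[u2 u1]; rewrite /concat_fun clampE; last by rewrite u1 andbT; lra.
by rewrite leNgt u2.
Qed.

Lemma concat_cstp {x y : X} (p : path x y) :
  path_homotopic (path_concat (path_cst x) p) p.
Proof.
apply: (path_homotopic_reparam (p := p)
  (f := fun s => uval (clamp (2 * uval s - 1))) (g := @uval R)).
- by prove_continuous.
- exact: uval_continuous.
- by rewrite uval0 mulr0 sub0r clamp_le0 ?lerN10 // clampE // lexx ler01.
- by rewrite uval1 (_ : 2 * 1 - 1 = 1) ?clampE ?lexx ?ler01 //; lra.
- move=> s; rewrite uvalK; change (concat_fun (path_cst x) p s =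
    p (clamp (2 * uval s - 1))); rewrite /concat_fun.
  have [u2|//] := leP; rewrite [in RHS]clamp_le0; last by lra.
  by rewrite -[clamp 0]/zero path_zero.
- by move=> s; rewrite uvalK.
Qed.

Lemma concat_pcst {x y : X} (p : path x y) :
  path_homotopic (path_concat p (path_cst y)) p.
Proof.
apply: (path_homotopic_reparam (p := p)
  (f := fun s => uval (clamp (2 * uval s))) (g := @uval R)).
- by prove_continuous.
- exact: uval_continuous.
- by rewrite uval0 mulr0 clampE // lexx ler01.
- rewrite uval1 clamp_ge1; last by lra.
  by rewrite clampE // lexx ler01.
- move=> s; rewrite uvalK; change (concat_fun p (path_cst y) s =
    p (clamp (2 * uval s))); rewrite /concat_fun.
  have [//|u2] := leP; rewrite [in RHS]clamp_ge1; last by lra.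
  by rewrite -[clamp 1]/one path_one.
- by move=> s; rewrite uvalK.
Qed.

Lemma concatpV {x y : X} (p : path x y) :
  path_homotopic (path_concat p (path_rev p)) (path_cst x).
Proof.
apply: (path_homotopic_reparam (p := p)
  (f := fun s => if uval s <= 2^-1 then 2 * uval s else 2 - 2 * uval s)
  (g := fun=> 0)).
- apply: continuous_glue; [by prove_continuous..|].
  by move=> s ->; lra.
- exact: continuous_const.
- by rewrite uval0 invr_ge0 ler0n mulr0.
- by rewrite uval1 ifF; [lra|apply/negbTE; rewrite -ltNge; lra].
- move=> s; change (concat_fun p (path_rev p) s =
    p (clamp (if uval s <= 2^-1 then 2 * uval s else 2 - 2 * uval s))).
  rewrite /concat_fun; case: leP => // u2.
  change (p (clamp (1 - uval (clamp (2 * uval s - 1)))) =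
    p (clamp (2 - 2 * uval s))).
  have /andP[u0 u1] := uval_itv s.
  by rewrite clampE; [congr (p (clamp _)); lra|apply/andP; split; lra].
- by move=> s; rewrite -[clamp 0]/zero path_zero.
Qed.

Lemma path_revK {x y : X} (p : path x y) : path_rev (path_rev p) = p.
Proof.
apply/path_eqP => s.
change (p (clamp (1 - uval (clamp (1 - uval s)))) = p s).
have /andP[u0 u1] := uval_itv s; rewrite clampE; last by apply/andP; split; lra.
by rewrite subKr uvalK.
Qed.

Lemma rev_concat {x y z : X} (p : path x y) (q : path y z) :
  path_rev (path_concat p q) = path_concat (path_rev q) (path_rev p).
Proof.
apply/path_eqP => s.
change (concat_fun p q (clamp (1 - uval s)) =
  concat_fun (path_rev q) (path_rev p) s).
rewrite -{2}(uvalK s); have /andP[] := uval_itv s.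
move: (uval s) => u u0 u1 {s}; have [u2|u2|->] := ltgtP u 2^-1.
- rewrite concat_fun_right; last by apply/andP; split; lra.
  rewrite concat_fun_left; last by apply/andP; split; lra.
  change (q (clamp (2 * (1 - u) - 1)) = q (clamp (1 - uval (clamp (2 * u))))).
  by rewrite clampE; [congr (q (clamp _)); lra|apply/andP; split; lra].
- rewrite concat_fun_left; last by apply/andP; split; lra.
  rewrite concat_fun_right; last by rewrite u2.
  change (p (clamp (2 * (1 - u))) =
    p (clamp (1 - uval (clamp (2 * u - 1))))).
  by rewrite clampE; [congr (p (clamp _)); lra|apply/andP; split; lra].
- rewrite concat_fun_left; last by apply/andP; split; lra.
  rewrite concat_fun_left; last by apply/andP; split; lra.
  rewrite mulfV ?pnatr_eq0 // (_ : 2 * (1 - 2^-1) = 1); last by lra.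
  by rewrite -[clamp 1]/one !path_one.
Qed.

Lemma concatVp {x y : X} (p : path x y) :
  path_homotopic (path_concat (path_rev p) p) (path_cst y).
Proof. by have := concatpV (path_rev p); rewrite path_revK. Qed.

Lemma concatA {x y z w : X} (p : path x y) (q : path y z) (r : path z w) :
  path_homotopic (path_concat p (path_concat q r))
                 (path_concat (path_concat p q) r).
Proof.
apply: path_homotopic_sym.
apply: (path_homotopic_reparam (p := path_concat p (path_concat q r))
  (f := fun s => if uval s <= 2^-1
                 then if uval s <= 4^-1 then 2 * uval s else uval s + 4^-1
                 else (uval s + 1) * 2^-1)
  (g := @uval R)).
- apply: continuous_glue; first by prove_continuous.
  + by apply: continuous_glue; [by prove_continuous..|move=> s ->; lra].
  + by prove_continuous.
  + by move=> s ->; case: ifP; lra.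
- exact: uval_continuous.
- by rewrite uval0 !invr_ge0 !ler0n mulr0.
- by rewrite uval1 ifF; [lra|apply/negbTE; rewrite -ltNge; lra].
- move=> s; set t := (X in clamp X).
  change (concat_fun (concat_fun p q) r s =
    concat_fun p (concat_fun q r) (clamp t)).
  rewrite -{1}(uvalK s) /t; have /andP[] := uval_itv s.
  move: (uval s) => u u0 u1 {t s}; case: (leP u 2^-1) => u2.
    rewrite concat_fun_left ?u0 //; case: leP => u4.
      by rewrite !concat_fun_left //; apply/andP; split; lra.
    rewrite (@concat_fun_right _ _ (2 * u)); last by apply/andP; split; lra.
    rewrite (@concat_fun_right _ _ (u + 4^-1)); last by apply/andP; split; lra.
    rewrite concat_fun_left; last by apply/andP; split; lra.
    by congr (q (clamp _)); lra.
  rewrite concat_fun_right; last by rewrite u2.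
  rewrite concat_fun_right; last by apply/andP; split; lra.
  rewrite concat_fun_right; last by apply/andP; split; lra.
  by congr (r (clamp _)); lra.
- by move=> s; rewrite uvalK.
Qed.

End homotopy.

Section fundamental_group.
Variables (R : realType) (X : topologicalType) (x : X).
Local Notation I := (unit_itv R).

Definition loop_space : Type := {path I from x to x in X}.
HB.instance Definition _ := Choice.on loop_space.
(* The library equips the path types with the compact-open topology. *)
HB.instance Definition _ := Topological.on loop_space.

Definition loop_homotopic (p q : loop_space) : bool :=
  `[< path_homotopic p q >].

Fact loop_homotopic_refl : reflexive loop_homotopic.
Proof. by move=> p; apply/asboolP; exact: path_homotopic_refl. Qed.

Fact loop_homotopic_sym : symmetric loop_homotopic.
Proof.
by move=> p q; apply/asboolP/asboolP; exact: path_homotopic_sym.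
Qed.

Fact loop_homotopic_trans : transitive loop_homotopic.
Proof.
move=> q p r /asboolP pq /asboolP qr; apply/asboolP.
exact: path_homotopic_trans pq qr.
Qed.

Canonical loop_homotopic_equiv :=
  EquivRel loop_homotopic loop_homotopic_refl loop_homotopic_sym
    loop_homotopic_trans.

Definition pi1 : Type := quotient_topology {eq_quot loop_homotopic}.
HB.instance Definition _ := Choice.on pi1.
HB.instance Definition _ := Quotient.on pi1.
HB.instance Definition _ := Topological.on pi1.

Definition loop_class (p : loop_space) : pi1 := \pi_pi1 p.

Lemma loop_classP (p q : loop_space) :
  loop_class p = loop_class q <-> path_homotopic p q.
Proof.
split=> [/eqmodP/asboolP //|pq].
by apply/eqmodP/asboolP.
Qed.

Lemma loop_class_repr (a : pi1) : loop_class (repr a) = a.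
Proof. exact: reprK. Qed.

Definition pi1_one : pi1 := loop_class (path_cst x).
Definition pi1_mul (a b : pi1) : pi1 :=
  loop_class (path_concat (repr a) (repr b)).
Definition pi1_inv (a : pi1) : pi1 := loop_class (path_rev (repr a)).

Lemma pi1_mulE (p q : loop_space) :
  pi1_mul (loop_class p) (loop_class q) = loop_class (path_concat p q).
Proof.
by apply/loop_classP/path_homotopic_concat; apply/loop_classP;
  exact: loop_class_repr.
Qed.

Lemma pi1_invE (p : loop_space) :
  pi1_inv (loop_class p) = loop_class (path_rev p).
Proof.
by apply/loop_classP/path_homotopic_rev/loop_classP; exact: loop_class_repr.
Qed.

Fact pi1_mulA : associative pi1_mul.
Proof.
move=> a b c; rewrite -(loop_class_repr a) -(loop_class_repr b).
rewrite -(loop_class_repr c) !pi1_mulE; apply/loop_classP; exact: concatA.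
Qed.

Fact pi1_mul1g : left_id pi1_one pi1_mul.
Proof.
move=> a; rewrite -(loop_class_repr a) pi1_mulE; apply/loop_classP.
exact: concat_cstp.
Qed.

Fact pi1_mulg1 : right_id pi1_one pi1_mul.
Proof.
move=> a; rewrite -(loop_class_repr a) pi1_mulE; apply/loop_classP.
exact: concat_pcst.
Qed.

Fact pi1_mulVg : left_inverse pi1_one pi1_inv pi1_mul.
Proof.
move=> a; rewrite -(loop_class_repr a) pi1_invE pi1_mulE; apply/loop_classP.
exact: concatVp.
Qed.

Fact pi1_mulgV : right_inverse pi1_one pi1_inv pi1_mul.
Proof.
move=> a; rewrite -(loop_class_repr a) pi1_invE pi1_mulE; apply/loop_classP.
exact: concatpV.
Qed.

HB.instance Definition _ := isGroup.Build pi1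
  pi1_mulA pi1_mul1g pi1_mulg1 pi1_mulVg pi1_mulgV.

Lemma open_pi1E (H : set pi1) : open H = open (loop_class @^-1` H).
Proof. by []. Qed.

Lemma pi1_mulgE (p q : loop_space) :
  (loop_class p * loop_class q)%g = loop_class (path_concat p q).
Proof. exact: pi1_mulE. Qed.

Lemma pi1_invgE (p : loop_space) :
  ((loop_class p)^-1)%g = loop_class (path_rev p).
Proof. exact: pi1_invE. Qed.

End fundamental_group.

Definition normal_subgroup (G : groupType) (H : set G) : Prop :=
  group_closed [in H] /\ forall a b : G, H a -> H (a ^ b)%g.

Section spanier_group.
Variables (R : realType) (X : topologicalType).
Local Notation I := (unit_itv R).

Definition open_cover (U : set (set X)) : Prop :=
  (forall V, U V -> open V) /\ \bigcup_(V in U) V = setT.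

Definition path_connected_set (A : set X) : Prop :=
  forall y z, A y -> A z ->
    exists p : {path I from y to z in X}, range p `<=` A.

Definition locally_path_connected : Prop :=
  forall (y : X) (A : set X), open_nbhs y A ->
    exists B, [/\ open_nbhs y B, path_connected_set B & B `<=` A].

Variable (x : X).

Definition spanier_loop (U : set (set X)) : set (loop_space R x) :=
  [set g | exists (y : X) (u : {path I from x to y in X})
                  (v : {path I from y to y in X}) (V : set X),
     [/\ U V, range v `<=` V &
         g = path_concat (path_concat u v) (path_rev u)]].

(* The empty product is the constant loop. *)
Definition loop_prod (s : seq (loop_space R x)) : loop_space R x :=
  foldr path_concat (path_cst x) s.

Definition spanier_group (U : set (set X)) : set (pi1 R x) :=
  [set a | exists s : seq (loop_space R x),
     (forall g, g \in s -> spanier_loop U g) /\ a = loop_class (loop_prod s)].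

Lemma loop_class_prod_cat (s t : seq (loop_space R x)) :
  loop_class (loop_prod (s ++ t)) =
  (loop_class (loop_prod s) * loop_class (loop_prod t))%g.
Proof.
elim: s => [|g s IHs] /=; first by rewrite [RHS]mul1g.
by rewrite -!pi1_mulgE IHs mulgA.
Qed.

Lemma spanier_loop_inv U g : spanier_loop U g ->
  exists2 h, spanier_loop U h & loop_class h = ((loop_class g)^-1)%g.
Proof.
move=> [y [u [v [V [UV vV ->]]]]].
exists (path_concat (path_concat u (path_rev v)) (path_rev u)).
  exists y, u, (path_rev v), V; split => // _ [s _ <-].
  by apply: vV; exists (clamp (1 - uval s)).
rewrite pi1_invgE; apply/loop_classP.
by rewrite !rev_concat path_revK; apply: path_homotopic_sym; exact: concatA.
Qed.

Lemma spanier_groupV U a : spanier_group U a -> spanier_group U (a^-1)%g.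
Proof.
move=> [s [sU ->]]; elim: s sU => [|g s IHs] sU /=.
  by exists [::]; split => //; rewrite [LHS]invg1.
have [t [tU tE]] : spanier_group U ((loop_class (loop_prod s))^-1)%g.
  by apply: IHs => h hs; apply: sU; rewrite in_cons hs orbT.
have [h hU hE] := spanier_loop_inv (sU g (mem_head _ _)).
exists (t ++ [:: h]); split.
  by move=> k; rewrite mem_cat mem_seq1 => /orP[/tU //|/eqP ->].
rewrite -pi1_mulgE invgM tE loop_class_prod_cat -hE /=; congr (_ * _)%g.
by rewrite -pi1_mulgE [RHS]mulg1.
Qed.

Lemma spanier_group_closed U : group_closed [in spanier_group U].
Proof.
split=> [|a b /set_mem aU /set_mem /spanier_groupV [t [tU tE]]]; apply/mem_set.
  by exists [::].
move: aU => [s [sU ->]]; exists (s ++ t); split.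
  by move=> g; rewrite mem_cat => /orP[/sU|/tU].
by rewrite tE loop_class_prod_cat.
Qed.

End spanier_group.

Arguments spanier_group R {X} x U.
Arguments locally_path_connected R X : clear implicits.

(* Main.v *)
(* A neighbourhood of the constant loop at y in the compact-open topology
   contains every loop lying in some open set V around y.  Hence, if u0 is a path
   from x to y, openness of H puts the classes of all u0 v u0^-1 with v in V into
   H.  A path connected V lets the base point of v move inside V, and normality
   of H allows u0 to be replaced by an arbitrary path; if no path joins x to y,
   then none ends in a path connected neighbourhood of y. *)
Require Import Defs.
From HB Require Import structures.
From mathcomp Require Import all_boot all_order all_algebra.
From mathcomp Require Import all_classical all_reals.
From mathcomp Require Import topology normedtype homotopy.
From Corelib Require Import -(notations) Setoid Morphisms.
Local Open Scope classical_set_scope.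

(** As [V] shrinks to [y], the sets of functions that agree with [f] off [D] and map [D] into [V]
    generate a filter converging to [f], so one of them lies inside [A]. *)
Lemma compact_open_perturb (T X : topologicalType)
    (A : set {compact-open, T -> X}) (f : T -> X) (D : set T) (y : X) :
  open A -> A f -> (forall t, D t -> f t = y) ->
  exists V, open_nbhs y V /\
    forall g : T -> X, (forall t, ~ D t -> g t = f t) ->
      (forall t, D t -> V (g t)) -> A g.
Proof.
move=> oA Af fy.
pose B (V : set X) := [set g : {compact-open, T -> X} |
  (forall t, ~ D t -> g t = f t) /\ forall t, D t -> V (g t)].
have FF : Filter (filter_from (open_nbhs y) B).
  apply: filter_from_filter => [|V W yV yW]; first by exists setT; exact: open_nbhsT.
  exists (V `&` W); first exact: open_nbhsI.
  by move=> g [gf gVW]; split; split => // t /gVW [].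
have : filter_from (open_nbhs y) B --> (f : {compact-open, T -> X}).
  apply/compact_open_cvgP => K O _ oO fKO.
  (* If [y] is in [O], take [V = O]. Otherwise [K] misses [D], where [f] is [y], and any [V]
     works. *)
  have [yO|yO] := pselect (O y).
    exists O => [//|g [gf gO] _ [t Kt <-]].
    have [/gO//|Dt] := pselect (D t).
    by rewrite gf //; apply: fKO; exists t.
  exists setT => [|g [gf _] _ [t Kt <-]]; first exact: open_nbhsT.
  have [Dt|Dt] := pselect (D t); last by rewrite gf //; apply: fKO; exists t.
  by case: yO; rewrite -(fy t Dt); apply: fKO; exists t.
move=> /(_ A) []; first by apply: open_nbhs_nbhs.
by move=> V yV VA; exists V; split => // g gf gV; exact: VA.
Qed.

Section paths.
Context {R : realType} {X : topologicalType}.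
Local Notation I := (unit_itv R).
Local Notation path x y := {path I from x to y in X}.

#[local] Instance path_homotopic_equivalence (x y : X) :
  Equivalence (@path_homotopic R X x y).
Proof.
split=> [p|p q|p q r]; [exact: path_homotopic_refl|exact: path_homotopic_sym|].
exact: path_homotopic_trans.
Qed.

#[local] Instance path_concat_proper (x y z : X) :
  Proper (respectful path_homotopic (respectful path_homotopic path_homotopic))
    (@path_concat R X x y z).
Proof. by move=> p p' pp' q q' qq'; exact: path_homotopic_concat. Qed.

Lemma concat_revK {x y z : X} (q : path x y) (p : path z y) :
  path_homotopic (path_concat (path_concat q (path_rev p)) p) q.
Proof. rewrite -concatA concatVp concat_pcst; exact: path_homotopic_refl. Qed.

(** Both inserted factors [p^-1 p] cancel; the outer factors become mutually inverse loops at
    [x]. *)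
Lemma path_conj_change {x z : X} (u p : path x z) (v : path z z) :
  path_homotopic (path_concat (path_concat u v) (path_rev u))
    (path_concat
      (path_concat (path_concat u (path_rev p))
        (path_concat (path_concat p v) (path_rev p)))
      (path_concat p (path_rev u))).
Proof. rewrite !concatA !concat_revK; exact: path_homotopic_refl. Qed.

Lemma path_conj_concat {x y z : X} (u : path x y) (w : path y z) (v : path z z) :
  path_homotopic
    (path_concat (path_concat u (path_concat (path_concat w v) (path_rev w)))
      (path_rev u))
    (path_concat (path_concat (path_concat u w) v) (path_rev (path_concat u w))).
Proof. rewrite rev_concat !concatA; exact: path_homotopic_refl. Qed.

Lemma range_concat_subset {x y z : X} (p : path x y) (q : path y z) (A : set X) :
  range p `<=` A -> range q `<=` A -> range (path_concat p q) `<=` A.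
Proof.
move=> pA qA _ [s _ <-]; rewrite /path_concat /= /mk_path /concat_fun.
by case: ifP => _; [apply: pA|apply: qA]; exact: imageP.
Qed.

Lemma range_rev_subset {x y : X} (p : path x y) (A : set X) :
  range p `<=` A -> range (path_rev p) `<=` A.
Proof. by move=> pA _ [s _ <-]; apply: pA; exact: imageP. Qed.

(* The loop [u v u^-1] runs through [v] exactly where the first branch of the
   outer concatenation meets the second branch of the inner one. *)
Lemma open_small_conj {x y : X} (O : set (loop_space R x)) (u : path x y) :
  open O ->
  O (path_concat (path_concat u (path_cst y)) (path_rev u)) ->
  exists V, open_nbhs y V /\
    forall v : path y y, range v `<=` V ->
      O (path_concat (path_concat u v) (path_rev u)).
Proof.
(* Open sets of loops are traces of open sets [A] of the compact-open function space. *)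
move=> [A oA <-] Au.
pose D := [set s : I | (uval s <= 2^-1)%R /\
                       ~~ (uval (clamp (2 * uval s)) <= 2^-1)%R].
have [|V [yV VA]] := @compact_open_perturb _ _ A _ D y oA Au.
  move=> s [s2 s4].
  by rewrite /path_concat /= /mk_path /concat_fun s2 /mk_path /concat_fun (negbTE s4).
exists V; split => // v vV; apply: VA => s.
  rewrite /path_concat /= /mk_path /concat_fun; case: ifP => // s2 Ds.
  rewrite /mk_path /concat_fun; case: ifP => // s4.
  by case: Ds; split => //; rewrite s4.
move=> [s2 s4].
rewrite /path_concat /= /mk_path /concat_fun s2 /mk_path /concat_fun (negbTE s4).
by apply: vV; exact: imageP.
Qed.

(** This is the form in which normality applies. The exponent is inverted because [a ^ b] means
    [b^-1 a b]. *)
Lemma loop_class_conj_change {x z : X} (u p : path x z) (v : path z z) :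
  loop_class (path_concat (path_concat u v) (path_rev u) : loop_space R x) =
  (loop_class (path_concat (path_concat p v) (path_rev p) : loop_space R x) ^
   (loop_class (path_concat u (path_rev p) : loop_space R x))^-1)%g.
Proof.
rewrite (iffRL (loop_classP _ _) (path_conj_change u p v)) -2!pi1_mulgE.
by rewrite conjgE invgK pi1_invgE rev_concat path_revK mulgA.
Qed.

End paths.

Theorem theorem2p1 (R : realType) (X : topologicalType) (x : X)
    (H : set (pi1 R x)) :
  locally_path_connected R X ->
  normal_subgroup H ->
  open H ->
  exists U : set (set X), open_cover U /\ spanier_group R x U `<=` H.
Proof.
move=> lpc [[/set_mem H1 HB] HJ] oH.
have HM a b : H a -> H b -> H (a * b)%g.
  (* [HB] is closure under [a b^-1], so [b] is written as [(1 b^-1)^-1]. *)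
  move=> Ha Hb; rewrite -[b]invgK -[b^-1%g]mul1g; apply/set_mem.
  by apply: (HB); [|apply: (HB)]; exact/mem_set.
(* With the largest possible family, the inclusion in [H] follows by induction on the product; the
   work lies in covering [X]. *)
pose U := [set V : set X | open V /\ forall g, spanier_loop [set V] g ->
                                       H (loop_class g)].
exists U; split; last first.
  move=> _ [s [sU ->]]; elim: s sU => [|g s IHs] sU //.
  rewrite /loop_prod /= -pi1_mulgE; apply: HM; last first.
    by apply: IHs => h hs; apply: sU; rewrite in_cons hs orbT.
  have [y [u [v [V [[_ UV] vV gE]]]]] := sU g (mem_head _ _).
  by apply: UV; exists y, u, v, V.
split=> [V []//|]; apply/seteqP; split=> // y _.
have [[u0]|nu] := pselect (inhabited {path unit_itv R from x to y in X}).
  have [|V [yV VH]] := open_small_conj (@loop_class R X x @^-1` H) u0 oH.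
    rewrite /preimage /=.
    suff -> : loop_class (path_concat (path_concat u0 (path_cst y)) (path_rev u0)
                : loop_space R x) = 1%g by [].
    apply/loop_classP; apply: path_homotopic_trans (concatpV u0).
    by apply: path_homotopic_concat;
      [exact: concat_pcst|exact: path_homotopic_refl].
  have [B [[oB By] pB BV]] := lpc y V yV.
  exists B => //; split=> // _ [z [u [v [_ [-> vB ->]]]]].
  have Bz : B z by rewrite -(@path_zero _ _ _ _ v); apply: vB; exact: imageP.
  have [w wB] := pB y z By Bz.
  (* Normality trades [u] for [u0 w]; then [w v w^-1] is a loop at [y] inside [B], hence inside
     [V]. *)
  rewrite (loop_class_conj_change u (path_concat u0 w)); apply: HJ.
  rewrite -(iffRL (loop_classP _ _) (path_conj_concat u0 w v)).
  apply: VH; apply: subset_trans BV.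
  by apply: range_concat_subset;
    [exact: range_concat_subset|exact: range_rev_subset].
(* Here [y] is unreachable from [x], so no Spanier loop for [B] exists: [u w^-1] would join [x] to
   [y]. *)
have [B [[oB By] pB _]] := lpc y setT (open_nbhsT y).
exists B => //; split=> // g [z [u [v [_ [-> vB _]]]]].
have Bz : B z by rewrite -(@path_zero _ _ _ _ v); apply: vB; exact: imageP.
have [w _] := pB y z By Bz.
by case: nu; split; exact: path_concat u (path_rev w).
Qed.
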